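(* Let $Y:=\mathbb{R}^k$ and let $\Gamma\in\mathbb{R}^{k\times k}$ be symmetric positive definite. Let $\mathcal{G}:X\to Y$ be a measurable function. Consider the Bayesian inverse problem with additive non-degenerate Gaussian noise $\eta\sim\mathrm{N}(0,\Gamma)$, given by the likelihood $$L(y^\dagger|\theta)=\det(2\pi\Gamma)^{-1/2}\exp\left(-\frac12\left\|\Gamma^{-1/2}(\mathcal{G}(\theta)-y^\dagger)\right\|_Y^2\right).$$ Then the Bayesian inverse problem corresponding to likelihood $L$ and (a) any prior $\mu_{\mathrm{prior}}\in\mathrm{Prob}(X)$ is weakly, Hellinger, and total variation well-posed; (b) any prior $\mu_{\mathrm{prior}}\in\mathrm{Prob}_p(X)$ is Wasserstein$(p)$ well-posed, where $p\in[1,\infty)$ and $X$ is a normed space.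
   Context: Setting. $Y=\mathbb{R}^k$ with the Euclidean norm $\|\cdot\|_Y$ and $\nu_Y$ the Lebesgue measure. The parameter space $X$ is a measurable subset of a separable, completely metrisable topological vector space $(X',\mathcal{T}')$, with Borel $\sigma$-algebra $\mathcal{B}X$ (when $X$ is a normed space, its norm $\|\cdot\|_X$ induces the topology). $\mathrm{Prob}(X)$ is the set of probability measures on $(X,\mathcal{B}X)$, $\mathrm{Prob}(X,\mu)$ the set of those absolutely continuous with respect to $\mu$, and for normed $X$, $\mathrm{Prob}_p(X):=\{\mu\in\mathrm{Prob}(X):\int\|\theta\|_X^p\,\mu(\mathrm{d}\theta)<\infty\}$. $\nu_X$ is a $\sigma$-finite measure on $(X,\mathcal{B}X)$ with $\mu_{\mathrm{prior}}\ll\nu_X$ and $\pi_{\mathrm{prior}}=\mathrm{d}\mu_{\mathrm{prior}}/\mathrm{d}\nu_X$ (one may take $\nu_X=\mu_{\mathrm{prior}}$, $\pi_{\mathrm{prior}}\equiv1$). Put $Z(y^\dagger):=\int_X L(y^\dagger|\theta)\,\mathrm{d}\mu_{\mathrm{prior}}(\theta)$. Bayesian inverse problem: for data $y^\dagger\in Y$, find the posterior $\mu_{\mathrm{post}}^\dagger\in\mathrm{Prob}(X,\mu_{\mathrm{prior}})$ with $\nu_X$-density $\theta\mapsto L(y^\dagger|\theta)\pi_{\mathrm{prior}}(\theta)/Z(y^\dagger)$. Well-posedness: let $(\mathrm{P},d)$ be a metric space with $\mathrm{P}\subseteq\mathrm{Prob}(X)$. The Bayesian inverse problem is $(\mathrm{P},d)$-well-posed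 if (1) for every $y^\dagger\in Y$, $\mu_{\mathrm{post}}^\dagger\in\mathrm{P}$ exists, (2) it is unique in $\mathrm{P}$, and (3) the map $(Y,\|\cdot\|_Y)\ni y^\dagger\mapsto\mu_{\mathrm{post}}^\dagger\in(\mathrm{P},d)$ is continuous. - Weak: $(\mathrm{P},d)=(\mathrm{Prob}(X),\mathrm{d}_{\mathrm{Prok}})$, where $\mathrm{d}_{\mathrm{Prok}}(\mu,\mu'):=\inf\{\varepsilon>0:\mu(B)\le\mu'(B^\varepsilon)+\varepsilon \text{ for all } B\in\mathcal{B}X\}$ and $B^\varepsilon:=\{b\in X:\ \exists b'\in B,\ d_X(b,b')<\varepsilon\}$, with $d_X$ a metric inducing the topology of $X$ ($d_X(b,b')=\|b-b'\|_X$ if $X$ is normed). - Total variation: $(\mathrm{P},d)=(\mathrm{Prob}(X),\mathrm{d}_{\mathrm{tv}})$, where $\mathrm{d}_{\mathrm{tv}}(\mu,\mu'):=\sup_{B\in\mathcal{B}X}|\mu(B)-\mu'(B)|$. - Hellinger: $(\mathrm{P},d)=(\mathrm{Prob}(X,\mu_{\mathrm{prior}}),\mathrm{d}_{\mathrm{Hel}})$, where $\mathrm{d}_{\mathrm{Hel}}(\mu,\mu'):=\sqrt{\tfrac12\int\left(\sqrt{\mathrm{d}\mu'/\mathrm{d}\mu_{\mathrm{prior}}}-\sqrt{\mathrm{d}\mu/\mathrm{d}\mu_{\mathrm{prior}}}\right)^2\mathrm{d}\mu_{\mathrm{prior}}}$. - Wasserstein$(p)$: $(\mathrm{P},d)=(\mathrm{Prob}_p(X),\mathrm{d}_{\mathrm{Was}(p)})$,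 where $\mathrm{d}_{\mathrm{Was}(p)}(\mu,\mu'):=\left(\inf_{\Lambda}\int_{X\times X}\|\theta-\theta'\|_X^p\,\mathrm{d}\Lambda(\theta,\theta')\right)^{1/p}$, the infimum running over all couplings $\Lambda\in\mathrm{Prob}(X^2)$ of $\mu$ and $\mu'$. *)

(* Defs.v *)
From HB Require Import structures.
From mathcomp Require Import all_boot all_order all_algebra.
From mathcomp Require Import all_classical all_reals all_analysis.

Set Implicit Arguments.
Unset Strict Implicit.
Unset Printing Implicit Defensive.

Import Order.TTheory GRing.Theory Num.Theory.
Import numFieldTopology.Exports numFieldNormedType.Exports.

Local Open Scope classical_set_scope.
Local Open Scope ring_scope.

Section metrics.
Context {R : realType} {T : topologicalType}.

Definition is_metric (dist : T -> T -> R) : Prop :=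
  [/\ forall x, dist x x = 0,
      forall x y, dist x y = 0 -> x = y,
      forall x y, dist x y = dist y x
    & forall x y z, dist x z <= dist x y + dist y z].

Definition induces_topology (dist : T -> T -> R) : Prop :=
  forall (x : T) (A : set T),
    nbhs x A <-> exists2 e, 0 < e & [set y | dist x y < e] `<=` A.

Definition complete_metric (dist : T -> T -> R) : Prop :=
  forall u : nat -> T,
    (forall e, 0 < e -> exists N, forall m n, (N <= m)%N -> (N <= n)%N ->
       dist (u m) (u n) < e) ->
    exists l : T, u @ \oo --> l.

End metrics.

Definition completely_metrizable (R : realType) (T : topologicalType) : Prop :=
  exists dist : T -> T -> R,
    [/\ is_metric dist, induces_topology dist & complete_metric dist].

Definition separable (T : topologicalType) : Prop :=
  exists2 S : set T, countable S & dense S.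

Section norms.
Context {R : realType} {V : lmodType R}.

Definition is_linear_subspace (X : set V) : Prop :=
  X 0 /\ forall (a : R) x y, X x -> X y -> X (a *: x + y).

(* Only the values of [nrm] on X matter. *)
Definition is_norm_on (X : set V) (nrm : V -> R) : Prop :=
  [/\ forall x, X x -> 0 <= nrm x,
      forall x, X x -> nrm x = 0 -> x = 0,
      forall (a : R) x, X x -> nrm (a *: x) = `|a| * nrm x
    & forall x y, X x -> X y -> nrm (x + y) <= nrm x + nrm y].

End norms.

(* The subset X as a topological space of its own, with the trace topology.
   Measurable types are pointed, whence the proof of nonemptiness; it excludes
   nothing, since there is no probability measure on the empty set. *)
Definition subspace_of {T : topologicalType} {X : set T} (X0 : X !=set0)
  : Type := set_type X.

Section subspace_of_instances.
Context {T : topologicalType} {X : set T} (X0 : X !=set0).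

Definition subspace_point : subspace_of X0 :=
  let: exist x Xx := cid X0 in exist _ x (mem_set Xx).

HB.instance Definition _ := Topological.copy (subspace_of X0) (set_type X).
HB.instance Definition _ := isPointed.Build (subspace_of X0) subspace_point.

End subspace_of_instances.

Definition subspace_val {T : topologicalType} {X : set T} (X0 : X !=set0)
  (x : subspace_of X0) : T := set_val x.
Arguments subspace_val {T X} X0 x.

Lemma open_subspace_of {T : topologicalType} {X : set T} (X0 : X !=set0)
    (U : set (subspace_of X0)) :
  open U <-> exists2 V : set T, open V & subspace_val X0 @^-1` V = U.
Proof. by split=> [[V oV <-]|[V oV <-]]; exists V. Qed.

Notation borel T := (g_sigma_algebraType (@open T)).

(* The library norm on matrices is the sup norm. *)
Definition enorm {R : realType} {k : nat} (v : 'cV[R]_k) : R :=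
  Num.sqrt (\sum_(i < k) v i ord0 ^+ 2).

Definition spd {R : realType} {k : nat} (A : 'M[R]_k) : Prop :=
  A^T = A /\ forall v : 'cV[R]_k, v != 0 -> 0 < (v^T *m A *m v) ord0 ord0.

(* A^{-1/2} for A symmetric positive definite: the (unique) symmetric positive
   definite square root of A^{-1}. *)
Definition invsqrtmx {R : realType} {k : nat} (A : 'M[R]_k) : 'M[R]_k :=
  xget 0 [set S : 'M[R]_k | spd S /\ S *m S = invmx A].

Definition gaussian_likelihood {R : realType} {k : nat} {T : Type}
    (Gamma : 'M[R]_k) (G : T -> 'cV[R]_k) (y : 'cV[R]_k) (theta : T) : R :=
  (\det ((2 * pi) *: Gamma)) `^ (- 2^-1) *
  expR (- 2^-1 * enorm (invsqrtmx Gamma *m (G theta - y)) ^+ 2).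

Section bip.
Context {d : measure_display} {T : measurableType d} {R : realType}.

(* [f] is a version of the derivative of [mu] with respect to [nu]. *)
Definition is_density (nu : {measure set T -> \bar R})
    (mu : {measure set T -> \bar R}) (f : T -> R) : Prop :=
  [/\ forall x, 0 <= f x,
      measurable_fun [set: T] f
    & forall A, measurable A -> mu A = (\int[nu]_(x in A) (f x)%:E)%E].

(* If the integral were 0 or infinite, then [evidence L prior y = 0] and, as
   division by 0 is 0, no probability measure would satisfy [is_posterior]. *)
Definition evidence {Y : Type} (L : Y -> T -> R) (prior : probability T R)
    (y : Y) : R :=
  fine (\int[prior]_theta (L y theta)%:E)%E.

Definition is_posterior {Y : Type} (L : Y -> T -> R) (prior : probability T R)
    (nu : {measure set T -> \bar R}) (pi_prior : T -> R)
    (y : Y) (mu : probability T R) : Prop :=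
  mu `<< prior /\
  is_density nu mu
    (fun theta => L y theta * pi_prior theta / evidence L prior y).

(* Library measures also assign values to non-measurable sets, so that equality
   in P is equality on measurable sets. Distances between measures are
   extended real numbers, so that no supremum or integral is truncated. *)
Definition well_posed {k : nat}
    (posterior : 'cV[R]_k -> probability T R -> Prop)
    (P : set (probability T R))
    (dist : probability T R -> probability T R -> \bar R) : Prop :=
  exists post : 'cV[R]_k -> probability T R,
    [/\ forall y, P (post y) /\ posterior y (post y),
        forall y mu, P mu -> posterior y mu ->
          forall B, measurable B -> mu B = post y B
      & forall y (e : R), 0 < e -> exists2 delta : R, 0 < delta &
          forall y', enorm (y' - y) < delta ->
            (dist (post y) (post y') < e%:E)%E].

Definition Prob : set (probability T R) := setT.

Definition Prob_ac (mu0 : probability T R) : set (probability T R) :=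
  [set mu : probability T R | mu `<< mu0].

Definition Prob_p (nrm : T -> R) (p : R) : set (probability T R) :=
  [set mu : probability T R | (\int[mu]_theta (nrm theta `^ p)%:E < +oo)%E].

Definition thickening (dist : T -> T -> R) (B : set T) (e : R) : set T :=
  [set b | exists2 b', B b' & dist b b' < e].

Definition d_Prok (dist : T -> T -> R) (mu mu' : probability T R) : \bar R :=
  ereal_inf [set e%:E | e in [set e : R | 0 < e /\
    forall B, measurable B ->
      (mu B <= mu' (thickening dist B e) + e%:E)%E]].

Definition d_tv (mu mu' : probability T R) : \bar R :=
  ereal_sup [set (`|mu B - mu' B|)%E | B in measurable].

Definition RN_density (mu mu0 : probability T R) (x : T) : R :=
  fine (Radon_Nikodym (charge_of_finite_measure mu) mu0 x).

Definition d_Hel (mu0 mu mu' : probability T R) : \bar R :=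
  sqrte ((2^-1)%:E * \int[mu0]_x
    ((Num.sqrt (RN_density mu' mu0 x) - Num.sqrt (RN_density mu mu0 x)) ^+ 2
      )%:E)%E.

Definition coupling (mu mu' : probability T R)
    (Lambda : probability (T * T)%type R) : Prop :=
  forall B, measurable B ->
    Lambda (B `*` setT) = mu B /\ Lambda (setT `*` B) = mu' B.

Definition d_Was (dist : T -> T -> R) (p : R) (mu mu' : probability T R)
  : \bar R :=
  (ereal_inf [set \int[Lambda]_z (dist z.1 z.2 `^ p)%:E
             | Lambda in coupling mu mu'] `^ p^-1)%E.

End bip.

Arguments d_Prok {d T R} & dist mu mu'.
Arguments d_Was {d T R} & dist p mu mu'.

(* Main.v *)
Require Import Defs.
From HB Require Import structures.
From mathcomp Require Import all_boot all_order all_algebra.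
From mathcomp Require Import all_classical all_reals all_analysis.
From mathcomp Require Import measurable_realfun ring lra.
Import Order.TTheory GRing.Theory Num.Theory.
Import numFieldTopology.Exports numFieldNormedType.Exports.
Local Open Scope classical_set_scope.
Local Open Scope ring_scope.

(** The Gaussian likelihood L(y | theta) is Lipschitz in y with a constant that
    does not depend on theta or on the forward map G: it is a constant times a
    product of one-dimensional factors exp (- s^2 / 2), each of which is
    1-Lipschitz with values in [0, 1] ([likelihood_lipschitz]). It is also
    positive and bounded by its normalising constant, so the evidence Z(y) is
    positive, finite and Lipschitz as well. Therefore the posterior density
    F y = L y / Z y with respect to the prior is continuous in y, uniformly in
    theta ([posterior_density_continuous]).

    Uniform closeness of densities with respect to a probability measure P
    controls all four distances. If |f - f'| <= e then
    - |mu B - mu' B| <= e for every measurable B, which bounds the total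
      variation and the Prokhorov distance;
    - (sqrt f' - sqrt f)^2 <= |f - f'|, which bounds the Hellinger distance by
      sqrt e;
    - the coupling that leaves the common mass min(f, f') P on the diagonal and
      couples the two remainders by their normalised product
      ([overlap_coupling]) bounds the p-th power of the Wasserstein distance by
      2 e 2^p times the p-th moment of P.

    The posterior is defined as the measure with density F y with respect to
    the prior. Its density with respect to the reference measure is
    F y * pi_prior, by the change of density formula ([density_integral]), and
    a measure is determined on measurable sets by its density.

    A symmetric square root of the inverse covariance is never needed: the
    estimates hold for any matrix in its place, and positive definiteness only
    serves to make the normalising constant nonzero. Similarly, in the bound on
    the Wasserstein distance the integral of the cost is estimated through the
    simple functions below it, so that the cost need not be measurable for the
    product sigma-algebra. *)

(** * The Gaussian likelihood *)

Lemma gauss1_lipschitz {R : realType} (s t : R) :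
  `|expR (- 2^-1 * s ^+ 2) - expR (- 2^-1 * t ^+ 2)| <= `|s - t|.
Proof.
wlog st : s t / s <= t.
  move=> h; case: (leP s t) => [/h //|/ltW /h].
  by rewrite distrC (distrC t).
pose f := fun x : R => expR (- 2^-1 * x ^+ 2).
pose df := fun x : R => - x * expR (- 2^-1 * x ^+ 2).
have fD (x : R) : is_derive x 1 f (df x).
  apply: is_derive_eq.
  rewrite /df /GRing.scale /=; by field.
have [|c _ fE] := @MVT_segment R f df s t st (fun x _ => fD x).
  apply: derivable_within_continuous => x _.
  exact: (@ex_derive _ _ _ _ _ _ _ (fD x)).
rewrite distrC (distrC s) -/(f t) -/(f s) fE normrM ler_piMl//.
rewrite /df normrM normrN (ger0_norm (expR_ge0 _)).
rewrite mulNr expRN -ler_pdivlMr ?invr_gt0 ?expR_gt0// invrK mul1r.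
(* the mean value theorem leaves |c| <= exp (c^2 / 2) to prove *)
apply: le_trans (expR_ge1Dx _).
by case: (ger0P c) => _; nra.
Qed.

Lemma normr_prodB_le {R : realDomainType} {I : Type} (r : seq I) (a b : I -> R) :
  (forall i, 0 <= a i <= 1) -> (forall i, 0 <= b i <= 1) ->
  `|\prod_(i <- r) a i - \prod_(i <- r) b i| <= \sum_(i <- r) `|a i - b i|.
Proof.
move=> a01 b01.
suff [] : [/\ 0 <= \prod_(i <- r) a i <= 1, 0 <= \prod_(i <- r) b i <= 1 &
  `|\prod_(i <- r) a i - \prod_(i <- r) b i| <= \sum_(i <- r) `|a i - b i|] by [].
pose K (x y z : R) := [/\ 0 <= x <= 1, 0 <= y <= 1 & `|x - y| <= z].
apply: (@big_rec3 _ _ _ K); first by rewrite /K subrr normr0 lexx ler01.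
move=> i x y z _ [/andP[x0 x1] /andP[y0 y1] xyz].
have /andP[a0 a1] := a01 i; have /andP[b0 b1] := b01 i.
split; rewrite ?mulr_ge0 ?mulr_ile1//.
have -> : a i * x - b i * y = (a i - b i) * x + b i * (x - y) by ring.
rewrite (le_trans (ler_normD _ _))// lerD// normrM.
  by rewrite ler_piMr// ger0_norm.
by rewrite (le_trans _ xyz)// ler_piMl// ger0_norm.
Qed.

Lemma coord_le_enorm {R : realType} {k : nat} (v : 'cV[R]_k) i :
  `|v i ord0| <= enorm v.
Proof.
rewrite -sqrtr_sqr /enorm ler_wsqrtr// (bigD1 i)//= lerDl.
by apply: sumr_ge0 => j _; exact: sqr_ge0.
Qed.

Lemma enorm_sqr {R : realType} {k : nat} (v : 'cV[R]_k) :
  enorm v ^+ 2 = \sum_(i < k) v i ord0 ^+ 2.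
Proof. by rewrite sqr_sqrtr// sumr_ge0// => i _; exact: sqr_ge0. Qed.

Lemma gauss_lipschitz {R : realType} {k : nat} (v w : 'cV[R]_k) :
  `|expR (- 2^-1 * enorm v ^+ 2) - expR (- 2^-1 * enorm w ^+ 2)| <=
  \sum_(i < k) `|v i ord0 - w i ord0|.
Proof.
rewrite !enorm_sqr !mulr_sumr !expR_sum.
have e01 (x : R) : 0 <= expR (- 2^-1 * x ^+ 2) <= 1.
  by rewrite expR_ge0 -expR0 ler_expR mulNr oppr_le0 mulr_ge0// sqr_ge0.
rewrite (le_trans (normr_prodB_le _ _ _ (fun=> e01 _) (fun=> e01 _)))//.
rewrite ler_sum// => i _.
exact: gauss1_lipschitz.
Qed.

Lemma det_spd_neq0 {R : realType} {k : nat} (A : 'M[R]_k) : spd A -> \det A != 0.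
Proof.
move=> [_ Apos]; apply/negP => /det0P [v v0 vA].
have /Apos : v^T != 0 by rewrite trmx_eq0.
by rewrite trmxK vA mul0mx mxE ltxx.
Qed.

Section likelihood.
Context {R : realType} {k : nat} {T : Type}.
Variables (Gamma : 'M[R]_k) (G : T -> 'cV[R]_k).
Hypothesis spdGamma : spd Gamma.
Local Notation L := (gaussian_likelihood Gamma G).
Local Notation c := ((\det ((2 * pi) *: Gamma)) `^ (- 2^-1)).

Lemma likelihood_cst_gt0 : 0 < c.
Proof.
have : \det ((2 * pi) *: Gamma) != 0.
  by rewrite detZ mulf_neq0 ?det_spd_neq0// expf_neq0 ?gt_eqF// mulr_gt0// pi_gt0.
by rewrite /powR => /negPf ->; exact: expR_gt0.
Qed.

Lemma likelihood_gt0 y theta : 0 < L y theta.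
Proof. by rewrite mulr_gt0 ?expR_gt0 ?likelihood_cst_gt0. Qed.

Lemma likelihood_le y theta : L y theta <= c.
Proof.
rewrite ler_piMr ?powR_ge0// -expR0 ler_expR mulNr oppr_le0 mulr_ge0//.
exact: sqr_ge0.
Qed.

(** The Lipschitz constant depends neither on the parameter nor on [G]. *)
Lemma likelihood_lipschitz : exists2 K : R, 0 <= K &
  forall y y' theta, `|L y theta - L y' theta| <= K * enorm (y' - y).
Proof.
pose S := invsqrtmx Gamma.
exists (c * \sum_(i < k) \sum_(j < k) `|S i j|) => [|y y' theta].
  by rewrite mulr_ge0 ?powR_ge0 ?sumr_ge0// => i _; exact: sumr_ge0.
rewrite /gaussian_likelihood -mulrBr normrM ger0_norm ?powR_ge0// -mulrA.
rewrite ler_wpM2l ?powR_ge0// (le_trans (gauss_lipschitz _ _))//.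
rewrite mulr_suml ler_sum// => i _.
have -> : (S *m (G theta - y)) i ord0 - (S *m (G theta - y')) i ord0 =
    (S *m (y' - y)) i ord0.
  have -> : y' - y = (G theta - y) - (G theta - y').
    by rewrite opprB [RHS]addrC subrKA.
  by rewrite [in RHS]mulmxBr [in RHS]mxE [X in _ = _ + X]mxE.
rewrite mxE (le_trans (ler_norm_sum _ _ _))// mulr_suml ler_sum// => j _.
by rewrite normrM ler_wpM2l// coord_le_enorm.
Qed.

End likelihood.

(** * Measurability for Borel sigma-algebras *)

Lemma measurable_fun_open_lt {R : realType} {T : ptopologicalType}
    (f : borel T -> R) :
  (forall a, open ([set x | f x < a] : set T)) -> measurable_fun [set: borel T] f.
Proof.
move=> fo; apply: (measurability _ (RGenInftyO.measurableE R)).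
move=> /= _ [_ [a ->] <-]; rewrite setTI; apply: sub_sigma_algebra.
have -> : f @^-1` `]-oo, a[ = [set x | f x < a].
  by apply/seteqP; split => x /=; rewrite in_itv.
exact: fo.
Qed.

Lemma measurable_coord {R : realType} {k : nat} (i : 'I_k) :
  measurable_fun [set: borel 'cV[R]_k] (fun v : borel 'cV[R]_k => v i ord0).
Proof.
apply: measurable_fun_open_lt => a.
apply: (@open_comp _ _ (fun v : 'cV[R]_k => v i ord0) [set x | x < a]).
  by move=> v _; exact: coord_continuous.
exact: open_lt.
Qed.

Lemma measurable_likelihood {R : realType} {k : nat} {d} {T : measurableType d}
    (Gamma : 'M[R]_k) (G : T -> borel 'cV[R]_k) (y : 'cV[R]_k) :
  measurable_fun [set: T] G ->
  measurable_fun [set: T] (gaussian_likelihood Gamma G y).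
Proof.
move=> mG; apply: measurable_funM => //; apply: measurableT_comp => //.
apply: measurable_funM => //.
under eq_fun do rewrite enorm_sqr.
apply: measurable_sum => i; apply: measurable_funX.
under eq_fun do rewrite mxE.
apply: measurable_sum => j; apply: measurable_funM => //.
under eq_fun do rewrite !mxE.
apply: measurable_funB => //.
exact: (measurableT_comp (measurable_coord j) mG).
Qed.

(** * Measures given by densities *)

Section density.
Context {d : measure_display} {T : measurableType d} {R : realType}.

(** Change of density: a version of the density is almost everywhere equal to
    the Radon-Nikodym derivative, for which the formula is known. *)
Lemma density_integral (nu : {sigma_finite_measure set T -> \bar R})
    (mu : {finite_measure set T -> \bar R}) (f : T -> R) (g : T -> \bar R)
    (E : set T) :
  is_density nu mu f -> measurable E -> measurable_fun E g ->
  (forall x, (0 <= g x)%E) ->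
  (\int[mu]_(x in E) g x = \int[nu]_(x in E) (g x * (f x)%:E))%E.
Proof.
move=> [f0 mf fE] mE mg g0.
have munu : mu `<< nu.
  apply/null_content_dominatesP => A mA nuA.
  rewrite [LHS]fE//; apply: null_set_integral => //.
    exact/measurable_EFinP/measurable_funTS.
have fRN : ae_eq nu E (Radon_Nikodym_SigmaFinite.f mu nu) (EFin \o f).
  apply: integral_ae_eq => //.
  - apply: integrableS (Radon_Nikodym_SigmaFinite.f_integrable munu) => //.
  - exact/measurable_EFinP/measurable_funTS.
  - by move=> A _ mA; rewrite -(Radon_Nikodym_SigmaFinite.f_integral munu mA) fE.
rewrite -(Radon_Nikodym_SigmaFinite.change_of_variables munu)//.
apply: ae_eq_integral => //.
- apply: emeasurable_funM => //; apply: measurable_funTS.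
  exact: measurable_int (Radon_Nikodym_SigmaFinite.f_integrable munu).
- apply: emeasurable_funM => //; exact/measurable_EFinP/measurable_funTS.
- by apply: filterS fRN => x /[apply] ->.
Qed.

Lemma bounded_integrable (P : {finite_measure set T -> \bar R}) (f : T -> R)
    (M : R) :
  measurable_fun setT f -> (forall x, 0 <= f x <= M) ->
  P.-integrable setT (EFin \o f).
Proof.
move=> mf fM; have mEf : measurable_fun setT (EFin \o f) by exact/measurable_EFinP.
apply/integrableP; split => //.
have M0 : (0 <= M%:E)%E.
  by have /andP[p0 pM] := fM point; rewrite lee_fin (le_trans p0 pM).
apply: le_lt_trans (integral_le_bound M%:E measurableT mEf M0 _) _.
  apply: aeW => x _ /=; have /andP[? ?] := fM x; rewrite lee_fin ger0_norm//.
by rewrite ltey_eq fin_numM// fin_num_measure.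
Qed.

End density.

Section weighted_measure.
Context {d : measure_display} {T : measurableType d} {R : realType}.
Variables (nu : {measure set T -> \bar R}) (f : T -> R).
Hypothesis f0 : forall x, 0 <= f x.
Hypothesis intf : nu.-integrable setT (EFin \o f).

(** The measure with density [f] with respect to [nu]. The two proofs are
    arguments so that the measure structure can be attached to the term. *)
Definition weighted_measure of (forall x, 0 <= f x) &
    nu.-integrable setT (EFin \o f) : set T -> \bar R :=
  fun A => (\int[nu]_(x in A) (f x)%:E)%E.

Local Notation mu := (weighted_measure f0 intf).

Let mu_set0 : mu set0 = 0%E.
Proof. by rewrite /weighted_measure integral_set0. Qed.

Let mu_ge0 A : (0 <= mu A)%E.
Proof. by apply: integral_ge0 => x _; rewrite lee_fin. Qed.

Let mu_sigma_additive : semi_sigma_additive mu.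
Proof.
by apply: semi_sigma_additive_nng_induced; first exact: measurable_int intf.
Qed.

HB.instance Definition _ :=
  isMeasure.Build _ _ _ mu mu_set0 mu_ge0 mu_sigma_additive.

Let mu_fin : fin_num_fun mu.
Proof.
move=> A mA; apply: integrable_fin_num => //.
exact: integrableS intf.
Qed.

HB.instance Definition _ := Measure_isFinite.Build _ _ _ mu mu_fin.

Lemma weighted_density : is_density nu mu f.
Proof. by split => //; apply/measurable_EFinP; exact: measurable_int intf. Qed.

End weighted_measure.

Section probability_of.
Context {d : measure_display} {T : measurableType d} {R : realType}.
Variables (mu : {measure set T -> \bar R}) (mu1 : mu setT = 1%E).

(** A measure of total mass one, as a probability measure. *)
Definition probability_of of mu setT = 1%E : set T -> \bar R := mu.

HB.instance Definition _ := Measure.copy (probability_of mu1) mu.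
HB.instance Definition _ :=
  Measure_isProbability.Build _ _ _ (probability_of mu1) mu1.

End probability_of.

(** * Coupling two measures that share a common part *)

Section integral_bounds.
Context {d : measure_display} {T : measurableType d} {R : realType}.
Local Open Scope ereal_scope.

Import HBNNSimple.

(** The integral of a nonnegative function, measurable or not, is the supremum
    of the integrals of the simple functions below it. *)
Lemma le_integral_simple (mu : {measure set T -> \bar R}) (h : T -> \bar R)
    (c : \bar R) :
  (forall x, 0 <= h x) ->
  (forall s : T -> R, measurable_fun setT s -> (forall x, 0 <= s x)%R ->
     (forall x, (s x)%:E <= h x) -> \int[mu]_x (s x)%:E <= c) ->
  \int[mu]_x h x <= c.
Proof.
move=> h0 hc; rewrite ge0_integralTE//; apply: ge_ereal_sup => _ [s sh <-].
by rewrite -integralT_nnsfun; apply: hc.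
Qed.

End integral_bounds.

Section overlap_coupling.
Context {d : measure_display} {T : measurableType d} {R : realType}.
Local Open Scope ereal_scope.

Variables (mu_m mu_a mu_b : {finite_measure set T -> \bar R}).
Hypothesis mass_ab : mu_a setT = mu_b setT.

Let diag (x : T) := (x, x).
Let mdiag : measurable_fun setT diag.
Proof. exact: measurable_fun_pair. Qed.

Let delta : R := fine (mu_a setT).
Let delta_ge0 : (0 <= delta)%R. Proof. exact: fine_ge0. Qed.
Let deltaV_ge0 : (0 <= delta^-1)%R. Proof. by rewrite invr_ge0. Qed.

Let mu_aT : mu_a setT = delta%:E.
Proof. by rewrite fineK// fin_num_measure. Qed.

Let mu_bT : mu_b setT = delta%:E. Proof. by rewrite -mass_ab mu_aT. Qed.

(* The common part sits on the diagonal, the remainders are coupled by their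
   normalised product. *)
Let Lambda : {measure set (T * T) -> \bar R} :=
  measure_add
   (measure_function_pushforward__canonical__measure_function_Measure mu_m mdiag)
   (mscale (NngNum deltaV_ge0) (mu_a \x mu_b)).

(* When delta = 0, its inverse is 0 too; the identity survives because [mu]
   vanishes. *)
Let remainder0 (mu : {measure set T -> \bar R}) A : measurable A ->
  mu setT = delta%:E -> delta^-1%:E * (mu A * delta%:E) = mu A.
Proof.
move=> mA muT; have [d0|d0] := eqVneq delta 0%R; last first.
  by rewrite muleCA -EFinM mulVf// mule1.
rewrite d0 mule0 mule0; apply/esym/eqP.
rewrite -measure_le0; have : mu A <= mu setT by rewrite le_measure// inE.
by rewrite muT d0.
Qed.

Let Lambda1 A : measurable A -> Lambda (A `*` setT) = mu_m A + mu_a A.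
Proof.
move=> mA; rewrite [LHS]measure_addE /= /mscale/= product_measure1E//.
rewrite -[mu_a A in RHS](remainder0 mu_a A mA mu_aT).
rewrite -[delta%:E in RHS]mu_aT mass_ab.
by congr (mu_m _ + _); apply/seteqP; split => x /= => [[]|].
Qed.

Let Lambda2 A : measurable A -> Lambda (setT `*` A) = mu_m A + mu_b A.
Proof.
move=> mA; rewrite [LHS]measure_addE /= /mscale/= product_measure1E//.
rewrite -[mu_b A in RHS](remainder0 mu_b A mA mu_bT).
rewrite -[delta%:E in RHS]mu_aT (muleC (mu_b A)).
by congr (mu_m _ + _); apply/seteqP; split => x /= => [[]|].
Qed.



Let integral_fst (g : T -> R) : measurable_fun setT g -> (forall x, 0 <= g x)%R ->
  delta^-1%:E * \int[mu_a \x mu_b]_z (g z.1)%:E = \int[mu_a]_x (g x)%:E.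
Proof.
move=> mg g0; have mEg : measurable_fun setT (EFin \o g) by exact/measurable_EFinP.
rewrite -[LHS](@ge0_integral_mscale _ _ _ _ _ _ (NngNum deltaV_ge0)); last 3 first.
- by [].
- by apply/measurable_EFinP; exact: measurableT_comp.
- by move=> z _; rewrite lee_fin.
rewrite -(@ge0_integral_pushforward _ _ _ _ _ fst measurable_fst _ setT
  (EFin \o g))//.
  apply: eq_measure_integral => A mA _; rewrite -[RHS](remainder0 mu_a A mA mu_aT).
  rewrite /pushforward /= /mscale /=.
  rewrite -[delta%:E in RHS]mu_bT -(product_measure1E mu_a mu_b mA measurableT).
  by congr (_ * (_ \x _) _); apply/seteqP; split => x /= => [|[]].
by move=> y _; rewrite lee_fin.
Qed.

Let integral_snd (g : T -> R) : measurable_fun setT g -> (forall x, 0 <= g x)%R ->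
  delta^-1%:E * \int[mu_a \x mu_b]_z (g z.2)%:E = \int[mu_b]_x (g x)%:E.
Proof.
move=> mg g0; have mEg : measurable_fun setT (EFin \o g) by exact/measurable_EFinP.
rewrite -[LHS](@ge0_integral_mscale _ _ _ _ _ _ (NngNum deltaV_ge0)); last 3 first.
- by [].
- by apply/measurable_EFinP; exact: measurableT_comp.
- by move=> z _; rewrite lee_fin.
rewrite -(@ge0_integral_pushforward _ _ _ _ _ snd measurable_snd _ setT
  (EFin \o g))//.
  apply: eq_measure_integral => A mA _; rewrite -[RHS](remainder0 mu_b A mA mu_bT).
  rewrite /pushforward /= /mscale /=.
  rewrite -[delta%:E in RHS]mu_aT (muleC (mu_b A)).
  rewrite -(product_measure1E mu_a mu_b measurableT mA).
  by congr (_ * (_ \x _) _); apply/seteqP; split => x /= => [|[]].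
by move=> y _; rewrite lee_fin.
Qed.

(** If [mu] and [mu'] share the part [mu_m], with remainders [mu_a] and [mu_b]
    of equal mass, some coupling charges only the remainders for any cost [h]
    that vanishes on the diagonal and is dominated by [g x + g y]. The same
    coupling serves all costs, and [h] need not be measurable. *)
Lemma overlap_coupling (mu mu' : probability T R) :
  (forall A, measurable A -> mu A = mu_m A + mu_a A) ->
  (forall A, measurable A -> mu' A = mu_m A + mu_b A) ->
  exists2 Lam : probability (T * T)%type R, coupling mu mu' Lam &
  forall (h : T * T -> R) (g : T -> R),
    measurable_fun setT g -> (forall x, 0 <= g x)%R ->
    (forall z, 0 <= h z)%R -> (forall x, h (x, x) = 0%R) ->
    (forall x y, h (x, y) <= g x + g y)%R ->
    \int[Lam]_z (h z)%:E <= \int[mu_a]_x (g x)%:E + \int[mu_b]_x (g x)%:E.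
Proof.
move=> muE mu'E.
have LT : Lambda setT = 1.
  by rewrite -setXTT Lambda1// -muE// probability_setT.
exists (probability_of Lambda LT) => [A mA|h g mg g0 h0 hd hg].
  by rewrite muE// mu'E//; split; [exact: Lambda1|exact: Lambda2].
apply: le_integral_simple => [z|s ms s0 sh]; first by rewrite lee_fin.
have mEs : measurable_fun setT (EFin \o s) by exact/measurable_EFinP.
rewrite [leLHS](_ : _ = \int[Lambda]_z (s z)%:E)//.
rewrite ge0_integral_measure_add//; last by move=> z _; rewrite lee_fin.
rewrite ge0_integral_pushforward//; last by move=> z _; rewrite lee_fin.
(* on the diagonal s <= h = 0, hence the common part contributes nothing *)
rewrite integral0_eq ?add0e; last first.
  move=> x _ /=; apply/eqP; rewrite eq_le !lee_fin s0 andbT.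
  by have := sh (diag x); rewrite lee_fin hd.
rewrite ge0_integral_mscale//; last by move=> z _; rewrite lee_fin.
rewrite -integral_fst// -integral_snd// -ge0_muleDr; last 2 first.
- by apply: integral_ge0 => z _; rewrite lee_fin.
- by apply: integral_ge0 => z _; rewrite lee_fin.
rewrite -ge0_integralD//; last 4 first.
- by move=> z _; rewrite lee_fin.
- by apply/measurable_EFinP; exact: measurableT_comp.
- by move=> z _; rewrite lee_fin.
- by apply/measurable_EFinP; exact: measurableT_comp.
apply: lee_wpmul2l => //; apply: ge0_le_integral => //.
- by move=> z _; rewrite lee_fin.
- by apply/measurable_EFinP/measurable_funD; exact: measurableT_comp.
- move=> [x y] _; apply: le_trans (sh (x, y)) _.
  by rewrite -EFinD lee_fin.
Qed.

End overlap_coupling.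

(** * Measures with uniformly close densities *)

Section densities_close.
Context {d : measure_display} {T : measurableType d} {R : realType}.
Variables (P : probability T R).
Local Open Scope ereal_scope.

Lemma density_integrable (mu : probability T R) (f : T -> R) :
  is_density P mu f -> P.-integrable setT (EFin \o f).
Proof.
move=> [f0 mf fE]; apply/integrableP; split; first exact/measurable_EFinP.
have -> : \int[P]_x `|(EFin \o f) x| = mu setT.
  by rewrite fE//; apply: eq_integral => x _; rewrite /= ger0_norm.
by rewrite probability_setT ltry.
Qed.

Variables (mu mu' : probability T R) (f f' : T -> R) (e : R).
Hypotheses (fmu : is_density P mu f) (f'mu' : is_density P mu' f').
Hypothesis ff' : forall x, (`|f x - f' x| <= e)%R.

Let f0 x : (0 <= f x)%R. Proof. by have [] := fmu. Qed.
Let f'0 x : (0 <= f' x)%R. Proof. by have [] := f'mu'. Qed.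
Let mf : measurable_fun setT f. Proof. by have [] := fmu. Qed.
Let mf' : measurable_fun setT f'. Proof. by have [] := f'mu'. Qed.
Let e0 : (0 <= e)%R. Proof. exact: le_trans (ff' point). Qed.

Lemma density_close_measure_le B : measurable B -> mu B <= mu' B + e%:E.
Proof.
have [_ _ muE] := fmu; have [_ _ mu'E] := f'mu'.
move=> mB; rewrite muE// mu'E//.
apply: (@le_trans _ _ (\int[P]_(x in B) ((f' x)%:E + e%:E))).
  apply: ge0_le_integral => //.
  - by move=> x _; rewrite lee_fin.
  - exact/measurable_EFinP/measurable_funTS.
  - by apply: emeasurable_funD => //; exact/measurable_EFinP/measurable_funTS.
  - move=> x _; rewrite -EFinD lee_fin -lerBlDl.
    exact: le_trans (ler_norm _) (ff' x).
rewrite ge0_integralD//; first last.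
- exact/measurable_EFinP/measurable_funTS.
- by move=> x _; rewrite lee_fin.
rewrite leeD2l// integral_cst//.
by rewrite -[leRHS]mule1 lee_wpmul2l ?lee_fin// probability_le1.
Qed.

Let m x := Num.min (f x) (f' x).

Let mm : measurable_fun setT m. Proof. exact: measurable_minr. Qed.

Let m0 x : (0 <= m x)%R. Proof. by rewrite le_min f0 f'0. Qed.
Let a0 x : (0 <= f x - m x)%R. Proof. by rewrite subr_ge0 ge_min lexx. Qed.
Let b0 x : (0 <= f' x - m x)%R.
Proof. by rewrite subr_ge0 ge_min lexx orbT. Qed.

Let mi : P.-integrable setT (EFin \o m).
Proof.
apply: (le_integrable measurableT _ _ (density_integrable mu f fmu)) => //.
  exact/measurable_EFinP.
by move=> x _; rewrite lee_fin !ger0_norm// ge_min lexx.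
Qed.

Let ai : P.-integrable setT (EFin \o (fun x => f x - m x)%R).
Proof.
apply: (le_integrable measurableT _ _ (density_integrable mu f fmu)) => //.
  by apply/measurable_EFinP; exact: measurable_funB.
by move=> x _; rewrite lee_fin !ger0_norm// lerBlDr lerDl.
Qed.

Let bi : P.-integrable setT (EFin \o (fun x => f' x - m x)%R).
Proof.
apply: (le_integrable measurableT _ _ (density_integrable mu' f' f'mu')) => //.
  by apply/measurable_EFinP; exact: measurable_funB.
by move=> x _; rewrite lee_fin !ger0_norm// lerBlDr lerDl.
Qed.

Let mu_m := weighted_measure P m m0 mi.
Let mu_a := weighted_measure P _ a0 ai.
Let mu_b := weighted_measure P _ b0 bi.

Let muE A : measurable A -> mu A = mu_m A + mu_a A.
Proof.
have [_ _ muE] := fmu; move=> mA; rewrite muE// -[in RHS]ge0_integralD//.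
- by apply: eq_integral => x _; rewrite -EFinD addrC subrK.
- by move=> x _; rewrite lee_fin.
- exact/measurable_EFinP/measurable_funTS.
- by move=> x _; rewrite lee_fin.
- by apply/measurable_EFinP/measurable_funTS; exact: measurable_funB.
Qed.

Let mu'E A : measurable A -> mu' A = mu_m A + mu_b A.
Proof.
have [_ _ muE'] := f'mu'; move=> mA; rewrite muE'// -[in RHS]ge0_integralD//.
- by apply: eq_integral => x _; rewrite -EFinD addrC subrK.
- by move=> x _; rewrite lee_fin.
- exact/measurable_EFinP/measurable_funTS.
- by move=> x _; rewrite lee_fin.
- by apply/measurable_EFinP/measurable_funTS; exact: measurable_funB.
Qed.

Let weighted_le (c : T -> R) c0 ci (g : T -> R) :
  (forall x, c x <= e)%R -> measurable_fun setT g -> (forall x, 0 <= g x)%R ->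
  \int[weighted_measure P c c0 ci]_x (g x)%:E <= e%:E * \int[P]_x (g x)%:E.
Proof.
move=> ce mg g0.
have mEg : measurable_fun setT (EFin \o g) by exact/measurable_EFinP.
rewrite (density_integral P _ c _ _ (weighted_density P c c0 ci))//.
rewrite -ge0_integralZl//; last by move=> x _; rewrite lee_fin.
apply: ge0_le_integral => //.
- by move=> x _; rewrite mule_ge0 ?lee_fin.
- by apply: emeasurable_funM => //; exact: measurable_int ci.
- exact: emeasurable_funM.
- by move=> x _; rewrite muleC lee_wpmul2r ?lee_fin.
Qed.

(** The common part has density min(f, f'); the densities of the remainders are
    the positive and negative parts of f - f', hence at most [e]. *)
Lemma density_close_coupling : exists2 Lam : probability (T * T)%type R,
  coupling mu mu' Lam &
  forall (h : T * T -> R) (g : T -> R),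
    measurable_fun setT g -> (forall x, 0 <= g x)%R ->
    (forall z, 0 <= h z)%R -> (forall x, h (x, x) = 0%R) ->
    (forall x y, h (x, y) <= g x + g y)%R ->
    \int[Lam]_z (h z)%:E <= (2 * e)%:E * \int[P]_x (g x)%:E.
Proof.
have mass_ab : mu_a setT = mu_b setT.
  have mfin : mu_m setT \is a fin_num by rewrite fin_num_measure.
  have ab : mu_a setT + mu_m setT = mu_b setT + mu_m setT.
    by rewrite ![_ + mu_m _]addeC -muE// -mu'E// !probability_setT.
  by rewrite -[LHS](addeK _ mfin) ab addeK.
have [Lam cLam hLam] := overlap_coupling mu_m mu_a mu_b mass_ab mu mu' muE mu'E.
exists Lam => // h g mg g0 h0 hd hg.
apply: le_trans (hLam h g mg g0 h0 hd hg) _.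
rewrite mulrDl mul1r EFinD ge0_muleDl ?lee_fin//.
apply: leeD; apply: weighted_le => // x; have := ff' x; rewrite ler_norml.
  by rewrite /m => /andP[_ ?]; case: (leP (f x) (f' x)); rewrite ?subrr.
rewrite /m => /andP[? _]; case: (leP (f x) (f' x)); rewrite ?subrr// => _.
by rewrite -lerN2 opprB.
Qed.

End densities_close.

Section distances.
Context {d : measure_display} {T : measurableType d} {R : realType}.
Variables (P : probability T R).
Variables (mu mu' : probability T R) (f f' : T -> R) (e : R).
Hypotheses (fmu : is_density P mu f) (f'mu' : is_density P mu' f').
Hypothesis ff' : forall x, `|f x - f' x| <= e.
Local Open Scope ereal_scope.

Let f'f x : (`|f' x - f x| <= e)%R. Proof. by rewrite distrC. Qed.
Let f0 x : (0 <= f x)%R. Proof. by have [] := fmu. Qed.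
Let f'0 x : (0 <= f' x)%R. Proof. by have [] := f'mu'. Qed.
Let e0 : (0 <= e)%R. Proof. exact: le_trans (ff' point). Qed.

Lemma density_close_tv : d_tv mu mu' <= e%:E.
Proof.
apply: ge_ereal_sup => _ [B mB <-].
have muB : mu B \is a fin_num by rewrite fin_num_measure.
have mu'B : mu' B \is a fin_num by rewrite fin_num_measure.
have h1 := density_close_measure_le P mu mu' f f' e fmu f'mu' ff' B mB.
have h2 := density_close_measure_le P mu' mu f' f e f'mu' fmu f'f B mB.
move: h1 h2; rewrite -(fineK muB) -(fineK mu'B) -!EFinD /= !lee_fin.
by move=> ? ?; rewrite ler_norml; apply/andP; split; lra.
Qed.

Lemma density_close_Prok (dist : T -> T -> R) (r : R) :
  (forall x, dist x x = 0%R) ->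
  (forall B s, measurable (thickening dist B s)) ->
  (0 < r)%R -> (e <= r)%R -> d_Prok dist mu mu' <= r%:E.
Proof.
move=> dxx mthick r0 er; apply: ereal_inf_lbound; exists r => //; split => // B mB.
have h1 := density_close_measure_le P mu mu' f f' e fmu f'mu' ff' B mB.
apply: le_trans h1 _; apply: leeD; last by rewrite lee_fin.
rewrite le_measure ?inE// => x Bx; exists x => //.
by rewrite dxx.
Qed.

(** The chosen Radon-Nikodym derivative agrees almost everywhere with any given
    version of the density. *)
Lemma RN_densityE (nu : probability T R) (g : T -> R) : is_density P nu g ->
  measurable_fun setT (RN_density nu P) /\
  ae_eq P setT (RN_density nu P) g.
Proof.
move=> gnu; have [g0 mg nuE] := gnu.
have nuP : charge_of_finite_measure nu `<< P.
  apply/null_content_dominatesP => A mA PA /=.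
  rewrite [LHS]nuE//; apply: null_set_integral => //.
  exact/measurable_EFinP/measurable_funTS.
have iRN := Radon_Nikodym_integrable nuP.
split; first by apply: measurableT_comp => //; exact: measurable_int iRN.
have : ae_eq P setT (Radon_Nikodym (charge_of_finite_measure nu) P) (EFin \o g).
  apply: integral_ae_eq => //; first exact/measurable_EFinP.
  by move=> A _ mA; rewrite -Radon_Nikodym_integral// -nuE.
by apply: filterS => x /= gE Tx; rewrite /RN_density gE.
Qed.

Let sqrt_le (x y : R) : (0 <= x)%R -> (0 <= y)%R ->
  ((Num.sqrt x - Num.sqrt y) ^+ 2 <= `|x - y|)%R.
Proof.
move=> x0 y0; rewrite -{2}(sqr_sqrtr x0) -{2}(sqr_sqrtr y0) subr_sqr normrM.
rewrite -real_normK ?num_real// expr2 ler_wpM2l//.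
have := sqrtr_ge0 x; have := sqrtr_ge0 y.
move: (Num.sqrt x) (Num.sqrt y) => a b b0 a0.
by rewrite [leRHS]ger0_norm ?addr_ge0// ler_norml; apply/andP; split; lra.
Qed.

Lemma density_close_Hel : d_Hel P mu mu' <= (Num.sqrt e)%:E.
Proof.
have [mr aer] := RN_densityE mu f fmu.
have [mr' aer'] := RN_densityE mu' f' f'mu'.
rewrite (_ : (Num.sqrt e)%:E = sqrte e%:E)// /d_Hel lee_sqrt ?lee_fin//.
apply: (@le_trans _ _ (2^-1%:E * \int[P]_x e%:E)); last first.
  rewrite integral_cst// [X in _ * (_ * X)](_ : _ = 1)//; last first.
    exact: probability_setT.
  by rewrite mule1 -EFinM lee_fin; have := e0; lra.
apply: lee_wpmul2l; first by rewrite lee_fin invr_ge0.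
apply: ae_ge0_le_integral => //.
- by move=> x _; rewrite lee_fin sqr_ge0.
- apply/measurable_EFinP; apply: measurable_funX; apply: measurable_funB;
    apply: measurableT_comp => //;
    by apply: continuous_measurable_fun; exact: sqrt_continuous.
apply: filterS2 aer aer' => x /(_ Logic.I) -> /(_ Logic.I) -> _.
by rewrite lee_fin (le_trans (sqrt_le _ _ (f'0 x) (f0 x))).
Qed.

Let powR_addr_le (a b p : R) : (0 <= a)%R -> (0 <= b)%R -> (0 <= p)%R ->
  ((a + b) `^ p <= 2 `^ p * a `^ p + 2 `^ p * b `^ p)%R.
Proof.
wlog ab : a b / (a <= b)%R.
  move=> h a0 b0 p0; case: (leP a b) => [ab|/ltW ba]; first exact: h.
  by rewrite (addrC a) (addrC (_ * a `^ p))%R; exact: h.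
move=> a0 b0 p0; apply: (@le_trans _ _ ((2 * b) `^ p)%R).
  by apply: ge0_ler_powR => //; rewrite ?nnegrE ?addr_ge0 ?mulr_ge0//; lra.
by rewrite powRM// lerDr mulr_ge0 ?powR_ge0.
Qed.

(** The cost [dist ^ p] is dominated by [2 ^ p * (n x ^ p + n y ^ p)]. *)
Lemma density_close_Was (dist : T -> T -> R) (n : T -> R) (p : R) :
  (forall x y, 0 <= dist x y)%R -> (forall x, dist x x = 0%R) ->
  (forall x, 0 <= n x)%R -> (forall x y, dist x y <= n x + n y)%R ->
  measurable_fun setT n -> (1 <= p)%R ->
  d_Was dist p mu mu' <=
    ((2 * e * 2 `^ p)%:E * \int[P]_x (n x `^ p)%:E) `^ p^-1.
Proof.
move=> d0 dxx n0 dn mn p1; have p0 : (0 < p)%R by exact: lt_le_trans p1.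
have np0 x : (0 <= n x `^ p)%R by exact: powR_ge0.
have mnp : measurable_fun setT (fun x => n x `^ p)%R.
  exact: (measurableT_comp (measurable_powR p)).
have [Lam cLam hLam] := density_close_coupling P mu mu' f f' e fmu f'mu' ff'.
apply: gt0_ler_poweR; rewrite ?invr_ge0 ?(ltW p0)//.
- rewrite in_itv /= leey andbT; apply: le_ereal_inf_tmp => _ [L _ <-].
  by apply: integral_ge0 => z _; rewrite lee_fin powR_ge0.
- rewrite in_itv /= leey andbT mule_ge0//.
    by rewrite lee_fin !mulr_ge0 ?powR_ge0.
  by apply: integral_ge0 => z _; rewrite lee_fin powR_ge0.
apply: (@le_trans _ _ (\int[Lam]_z (dist z.1 z.2 `^ p)%:E)).
  by apply: ereal_inf_lbound; exists Lam.
rewrite EFinM -muleA -ge0_integralZl//; last 2 first.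
- exact/measurable_EFinP.
- by move=> x _; rewrite lee_fin.
under [in leRHS]eq_integral do rewrite -EFinM.
apply: hLam => //.
- exact: measurable_funM.
- by move=> x; rewrite mulr_ge0 ?powR_ge0.
- by move=> z; rewrite powR_ge0.
- by move=> x /=; rewrite dxx powR0// gt_eqF.
- move=> x y /=; apply: le_trans (powR_addr_le _ _ _ (n0 x) (n0 y) (ltW p0)).
  by apply: ge0_ler_powR => //; rewrite ?nnegrE ?addr_ge0// ltW.
Qed.

End distances.

(** * The posterior and its continuity in the data *)

(** The condition on [t] keeps the denominator [z'] above [z / 2]. *)
Lemma quotient_lipschitz {R : realFieldType} (l l' z z' c t : R) :
  0 < z -> t < z / 2 -> 0 <= l' <= c -> `|l - l'| <= t -> `|z - z'| <= t ->
  `|l / z - l' / z'| <= t * (z^-1 + 2 * c / z ^+ 2).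
Proof.
move=> z0 tz /andP[l'0 l'c] ll' zz'.
have z'z : z / 2 <= z' by move: zz'; rewrite ler_norml => /andP[]; lra.
have z'0 : 0 < z' by lra.
have t0 : 0 <= t by exact: le_trans ll'.
have c0 : 0 <= c by exact: le_trans l'c.
have -> : l / z - l' / z' = (l - l') / z + l' * (z' - z) / (z * z').
  by field; rewrite !gt_eqF.
rewrite [leRHS]mulrDr (le_trans (ler_normD _ _))// lerD//.
  by rewrite normrM (@gtr0_norm _ z^-1) ?invr_gt0// ler_pM2r ?invr_gt0.
have zz'0 : 0 < z * z' by rewrite mulr_gt0.
rewrite normrM normfV (gtr0_norm zz'0) ler_pdivrMr// normrM (ger0_norm l'0).
rewrite (distrC z'); apply: (@le_trans _ _ (c * t)); first exact: ler_pM.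
have -> : t * (2 * c / z ^+ 2) * (z * z') = (c * t) * (2 * z' / z).
  by field; rewrite gt_eqF.
by rewrite ler_peMr ?mulr_ge0// ler_pdivlMr//; lra.
Qed.

Section posterior.
Context {k : nat} {d : measure_display} {T : measurableType d} {R : realType}.
Variables (Gamma : 'M[R]_k) (G : T -> borel 'cV[R]_k).
Hypotheses (spdGamma : spd Gamma) (mG : measurable_fun [set: T] G).
Variable prior : probability T R.

Local Notation L := (gaussian_likelihood Gamma G).
Local Notation c := ((\det ((2 * pi) *: Gamma)) `^ (- 2^-1)).
Local Notation Z := (evidence L prior).

Let mL y : measurable_fun [set: T] (L y).
Proof. exact: measurable_likelihood. Qed.

Let L0 y theta : 0 < L y theta. Proof. exact: likelihood_gt0. Qed.

Let Li y : prior.-integrable setT (EFin \o L y).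
Proof.
apply: (bounded_integrable _ _ c) => // theta.
by rewrite ltW//= likelihood_le.
Qed.

Let ZE y : (\int[prior]_theta (L y theta)%:E)%E = (Z y)%:E.
Proof. by rewrite /evidence fineK//; exact: integrable_fin_num (Li y). Qed.

Lemma evidence_gt0 y : 0 < Z y.
Proof.
have Z0 : 0 <= Z y.
  by rewrite -lee_fin -ZE; apply: integral_ge0 => x _; rewrite lee_fin ltW.
rewrite lt_neqAle Z0 andbT eq_sym; apply/eqP => Zy0.
have mEL : measurable_fun setT (EFin \o L y) by exact/measurable_EFinP.
have : (\int[prior]_theta `|(EFin \o L y) theta|)%E = 0%E.
  transitivity (\int[prior]_theta (L y theta)%:E)%E; last by rewrite ZE Zy0.
  by apply: eq_integral => x _; rewrite /= ger0_norm ?ltW.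
move/(ae_eq_integral_abs prior measurableT mEL) => [N [mN N0 LN]].
have NT : N = setT.
  apply/seteqP; split => // x _; apply: LN => /(_ Logic.I)/= [] L0'.
  by have := L0 y x; rewrite L0' ltxx.
have := probability_setT prior; rewrite -NT N0 => /eqP.
by rewrite eqe eq_sym oner_eq0.
Qed.

Let evidence_le y y' t : 0 <= t -> (forall theta, L y theta <= L y' theta + t) ->
  Z y <= Z y' + t.
Proof.
move=> t0 Lt; suff : (\int[prior]_theta (L y theta)%:E <=
    \int[prior]_theta (L y' theta)%:E + t%:E)%E.
  by rewrite (ZE y) (ZE y') -EFinD lee_fin.
apply: (@le_trans _ _ (\int[prior]_theta ((L y' theta)%:E + t%:E))%E).
  apply: ge0_le_integral => //.
  - by move=> x _; rewrite lee_fin ltW.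
  - exact/measurable_EFinP.
  - by apply: emeasurable_funD => //; exact/measurable_EFinP.
  - by move=> x _; rewrite -EFinD lee_fin.
rewrite ge0_integralD//; first last.
- exact/measurable_EFinP.
- by move=> x _; rewrite lee_fin ltW.
rewrite leeD2l// integral_cst//.
by rewrite -[leRHS]mule1 lee_wpmul2l ?lee_fin// probability_le1.
Qed.

Let F y theta := L y theta / Z y.

Let F0 y theta : 0 <= F y theta.
Proof. by apply: divr_ge0; rewrite ltW// evidence_gt0. Qed.

Let mF y : measurable_fun setT (F y).
Proof. exact: measurable_funM. Qed.

Lemma posterior_density_bounded y theta : F y theta <= c / Z y.
Proof. by rewrite ler_pM2r ?invr_gt0 ?evidence_gt0// likelihood_le. Qed.

Let Fi y : prior.-integrable setT (EFin \o F y).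
Proof.
apply: (bounded_integrable _ _ (c / Z y)) => // theta.
by rewrite F0 posterior_density_bounded.
Qed.

Let F1 y : weighted_measure prior (F y) (F0 y) (Fi y) setT = 1%E.
Proof.
rewrite /weighted_measure /F; under eq_integral do rewrite EFinM.
rewrite ge0_integralZr ?ZE//; last 3 first.
- exact/measurable_EFinP.
- by move=> x _; rewrite lee_fin ltW.
- by rewrite lee_fin invr_ge0 ltW// evidence_gt0.
by rewrite -EFinM mulfV// gt_eqF// evidence_gt0.
Qed.

(** The measure with density [L y / Z y] with respect to the prior. *)
Definition posterior (y : 'cV[R]_k) : probability T R := probability_of _ (F1 y).

Lemma posterior_density y : is_density prior (posterior y) (F y).
Proof. exact: weighted_density. Qed.

Lemma posterior_dominated y : posterior y `<< prior.
Proof.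
have [_ _ postE] := posterior_density y.
apply/null_content_dominatesP => A mA PA; rewrite [LHS]postE//.
by apply: null_set_integral => //; exact/measurable_EFinP/measurable_funTS.
Qed.

Lemma is_posterior_posterior (nu : {sigma_finite_measure set T -> \bar R})
    (pi_prior : T -> R) y :
  is_density nu prior pi_prior -> is_posterior L prior nu pi_prior y (posterior y).
Proof.
move=> piE; have [pi0 mpi _] := piE; have [_ _ postE] := posterior_density y.
split; first exact: posterior_dominated.
split=> [theta||A mA].
- apply: divr_ge0; last by rewrite ltW// evidence_gt0.
  by rewrite mulr_ge0// ltW.
- by apply: measurable_funM => //; exact: measurable_funM.
rewrite postE// (density_integral nu prior pi_prior)//; last 2 first.
- exact/measurable_EFinP/measurable_funTS.
- by move=> x; rewrite lee_fin.
by apply: eq_integral => x _; rewrite -EFinM /F mulrAC.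
Qed.

(** Continuity in the data is uniform over the parameter. *)
Lemma posterior_density_continuous y (e : R) : 0 < e ->
  exists2 delta : R, 0 < delta & forall y', enorm (y' - y) < delta ->
    forall theta, `|F y theta - F y' theta| <= e.
Proof.
move=> e0; have [K K0 LK] := likelihood_lipschitz Gamma G.
pose z := Z y; have z0 : 0 < z := evidence_gt0 y.
have c0 : 0 < c by exact: likelihood_cst_gt0.
(* the factor of [quotient_lipschitz] *)
pose D := z^-1 + 2 * c / z ^+ 2.
have D0 : 0 < D by rewrite addr_gt0 ?divr_gt0 ?invr_gt0 ?mulr_gt0 ?exprn_gt0.
(* K + 1 instead of K keeps the denominator positive *)
exists (Num.min (z / 2) (e / D) / (K + 1)) => [|y'].
  by rewrite divr_gt0 ?lt_min ?divr_gt0//; lra.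
rewrite ltr_pdivlMr; last by lra.
pose t := K * enorm (y' - y).
have t0 : 0 <= t by rewrite mulr_ge0// sqrtr_ge0.
have n0 : 0 <= enorm (y' - y) by exact: sqrtr_ge0.
rewrite mulrDr mulr1 mulrC -/t => tlt.
have {tlt} : t < Num.min (z / 2) (e / D) by apply: le_lt_trans tlt; lra.
rewrite lt_min => /andP[tz te] theta.
have ZZ : `|z - Z y'| <= t.
  have LKt x := LK y y' x; rewrite -/t in LKt.
  have le1 : z <= Z y' + t.
    by apply: (evidence_le y y' t t0) => x; exact: ler_distlDr (LKt x).
  have le2 : Z y' <= z + t.
    by apply: (evidence_le y' y t t0) => x; exact: ler_distlCDr (LKt x).
  by rewrite ler_norml; apply/andP; split; lra.
apply: (@le_trans _ _ (t * D)); last by rewrite -ler_pdivlMr// ltW.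
apply: quotient_lipschitz => //.
by rewrite ltW//= likelihood_le.
Qed.

(** Well-posedness reduces to bounding the distance of two posteriors by the
    uniform distance of their densities. *)
Lemma posterior_well_posed (nu : {sigma_finite_measure set T -> \bar R})
    (pi_prior : T -> R) (PP : set (probability T R))
    (dist : probability T R -> probability T R -> \bar R) :
  is_density nu prior pi_prior ->
  (forall y, PP (posterior y)) ->
  (forall y (e : R), 0 < e -> exists2 r : R, 0 < r & forall y',
    (forall theta, `|F y theta - F y' theta| <= r) ->
    (dist (posterior y) (posterior y') < e%:E)%E) ->
  well_posed (is_posterior L prior nu pi_prior) PP dist.
Proof.
move=> piE PPpost distc; exists posterior; split.
- by move=> y; split => //; exact: is_posterior_posterior.
- move=> y mu _ [_ [_ _ muE]] B mB.
  have [_ [_ _ postE]] := is_posterior_posterior nu pi_prior y piE.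
  by rewrite muE// postE.
- move=> y e e0; have [r r0 yr] := distc y e e0.
  have [delta delta0 ydelta] := posterior_density_continuous y r r0.
  by exists delta => // y' /ydelta; exact: yr.
Qed.

Section distances_between_posteriors.
Variables (nu : {sigma_finite_measure set T -> \bar R}) (pi_prior : T -> R).
Hypothesis piE : is_density nu prior pi_prior.

Let half_lt (e : R) : 0 < e -> ((e / 2)%:E < e%:E)%E.
Proof. by move=> e0; rewrite lte_fin; lra. Qed.

Lemma weak_well_posed (dist : T -> T -> R) :
  (forall x, dist x x = 0) ->
  (forall B s, measurable (thickening dist B s)) ->
  well_posed (is_posterior L prior nu pi_prior) Prob (d_Prok dist).
Proof.
move=> dxx mthick; apply: posterior_well_posed => // y e e0.
exists (e / 2) => [|y' yy']; first by lra.
apply: le_lt_trans (half_lt e e0).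
have e20 : 0 < e / 2 by lra.
exact: (density_close_Prok prior _ _ (F y) (F y') (e / 2)
  (posterior_density y) (posterior_density y')).
Qed.

Lemma tv_well_posed :
  well_posed (is_posterior L prior nu pi_prior) Prob d_tv.
Proof.
apply: posterior_well_posed => // y e e0.
exists (e / 2) => [|y' yy']; first by lra.
apply: le_lt_trans (half_lt e e0).
exact: (density_close_tv prior _ _ (F y) (F y') (e / 2)
  (posterior_density y) (posterior_density y')).
Qed.

Lemma Hel_well_posed :
  well_posed (is_posterior L prior nu pi_prior) (Prob_ac prior) (d_Hel prior).
Proof.
apply: posterior_well_posed => // [y|y e e0]; first exact: posterior_dominated.
exists ((e / 2) ^+ 2) => [|y' yy']; first by rewrite exprn_gt0//; lra.
apply: le_lt_trans (half_lt e e0).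
have e20 : 0 <= e / 2 by lra.
rewrite -[in leRHS](ger0_norm e20) -sqrtr_sqr.
exact: (density_close_Hel prior _ _ (F y) (F y') ((e / 2) ^+ 2)
  (posterior_density y) (posterior_density y')).
Qed.

Lemma Was_well_posed (dist : T -> T -> R) (n : T -> R) (p : R) :
  (forall x y, 0 <= dist x y) -> (forall x, dist x x = 0) ->
  (forall x, 0 <= n x) -> (forall x y, dist x y <= n x + n y) ->
  measurable_fun setT n -> 1 <= p -> Prob_p n p prior ->
  well_posed (is_posterior L prior nu pi_prior) (Prob_p n p) (d_Was dist p).
Proof.
move=> d0 dxx n0 dn mn p1 pp; have p0 : 0 < p by exact: lt_le_trans p1.
have np0 x : 0 <= n x `^ p by exact: powR_ge0.
have mnp : measurable_fun setT (fun x => n x `^ p).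
  exact: (measurableT_comp (measurable_powR p)).
have mEnp : measurable_fun setT (fun x => (n x `^ p)%:E) by exact/measurable_EFinP.
have I0 : (0 <= \int[prior]_x (n x `^ p)%:E)%E.
  by apply: integral_ge0 => x _; rewrite lee_fin.
pose K := fine (\int[prior]_x (n x `^ p)%:E)%E.
have KE : (\int[prior]_x (n x `^ p)%:E)%E = K%:E.
  by rewrite /K fineK// ge0_fin_numE.
have K0 : 0 <= K by rewrite -lee_fin -KE.
apply: posterior_well_posed => // [y|y e e0].
  rewrite /Prob_p /= (density_integral _ _ _ _ _ (posterior_density y))//.
  apply: (@le_lt_trans _ _ ((c / Z y)%:E * K%:E)%E); last by rewrite -EFinM ltry.
  rewrite -KE -ge0_integralZl//; last 2 first.
  - by move=> x _; rewrite lee_fin.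
  - by rewrite lee_fin (le_trans (F0 y point))// posterior_density_bounded.
  apply: ge0_le_integral => //.
  - by move=> x _; rewrite mule_ge0 ?lee_fin.
  - by apply: emeasurable_funM => //; exact/measurable_EFinP.
  - exact: emeasurable_funM.
  - move=> x _; rewrite muleC lee_wpmul2r ?lee_fin//.
    exact: posterior_density_bounded.
have C0 : 0 < 2 * 2 `^ p * (K + 1) by rewrite !mulr_gt0 ?powR_gt0//; lra.
have r0 : 0 < (e / 2) `^ p by rewrite powR_gt0//; lra.
(* chosen so that the bound on the p-th power of the Wasserstein distance is at
   most (e / 2) ^ p *)
exists ((e / 2) `^ p / (2 * 2 `^ p * (K + 1))) => [|y' yy'].
  by rewrite divr_gt0.
set r := _ / _ in yy'.
apply: le_lt_trans (half_lt e e0).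
apply: le_trans (density_close_Was prior _ _ (F y) (F y') r
  (posterior_density y) (posterior_density y') yy' dist n p d0 dxx n0 dn mn p1) _.
have rp : 0 < r by rewrite divr_gt0.
rewrite KE -EFinM poweR_EFin lee_fin.
have e20 : 0 <= e / 2 by lra.
have -> : e / 2 = ((e / 2) `^ p) `^ p^-1.
  by rewrite -powRrM mulfV ?gt_eqF// powRr1.
apply: ge0_ler_powR; rewrite ?nnegrE ?invr_ge0 ?powR_ge0 ?(ltW p0)//.
  by rewrite mulr_ge0// mulr_ge0 ?powR_ge0// mulr_ge0// ltW.
rewrite -[leRHS](divfK (lt0r_neq0 C0)) -/r.
rewrite (_ : 2 * r * 2 `^ p * K = r * (2 * 2 `^ p * K)); last by ring.
by rewrite ler_pM2l// ler_pM2l ?mulr_gt0 ?powR_gt0//; lra.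
Qed.

End distances_between_posteriors.

End posterior.

(** * Topologies given by metrics and norms *)

Section metric_topology.
Context {R : realType} {T : topologicalType}.
Variable dist : T -> T -> R.
Hypotheses (dist_metric : is_metric dist) (dist_top : induces_topology dist).

Lemma metric_ball_open c s : open [set b | dist b c < s].
Proof.
have [_ _ sym tri] := dist_metric.
rewrite openE => b /= bs; apply/dist_top; exists (s - dist b c).
  by rewrite subr_gt0.
move=> y /=; rewrite (sym b y) => yb.
by apply: le_lt_trans (tri y b c) _; rewrite -ltrBrDr.
Qed.

End metric_topology.

Lemma thickening_measurable {R : realType} {T : ptopologicalType}
    (dist : T -> T -> R) (B : set (borel T)) (s : R) :
  is_metric dist -> induces_topology dist ->
  measurable (@thickening _ (borel T) R dist B s).
Proof.
move=> dist_metric dist_top; apply: sub_sigma_algebra.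
have -> : @thickening _ (borel T) R dist B s =
    \bigcup_(c in B) [set b | dist b c < s] by [].
by apply: (@bigcup_open T) => c _; exact: metric_ball_open.
Qed.

Section norm_metric.
Context {R : realType} {X' : topologicalLmodType R} {X : set X'} (X0 : X !=set0).
Variable nrm : X' -> R.
Hypotheses (linX : is_linear_subspace X) (nrmX : is_norm_on X nrm).
Local Notation v := (subspace_val X0).
Let dX (x y : subspace_of X0) := nrm (v x - v y).

Let Xv x : X (v x). Proof. by have := svalP x; rewrite inE. Qed.

Let XB x y : X x -> X y -> X (x - y).
Proof.
by move=> Xx Xy; rewrite addrC -scaleN1r; apply: linX.2.
Qed.

Let XN x : X x -> X (- x).
Proof. by move=> Xx; rewrite -sub0r; apply: XB => //; exact: linX.1. Qed.

Let nrmN x : X x -> nrm (- x) = nrm x.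
Proof.
by have [_ _ nZ _] := nrmX; move=> Xx; rewrite -scaleN1r nZ// normrN1 mul1r.
Qed.

Let nrm0 : nrm 0 = 0.
Proof.
have [_ _ nZ _] := nrmX.
by rewrite -(scale0r (0 : X')) nZ ?normr0 ?mul0r//; exact: linX.1.
Qed.

Lemma norm_metric : is_metric dX.
Proof.
have [n0 nI nZ nD] := nrmX; split.
- by move=> x; rewrite /dX subrr.
- move=> x y /(nI _ (XB _ _ (Xv x) (Xv y)))/subr0_eq vxy; exact: val_inj.
- by move=> x y; rewrite /dX -opprB nrmN//; exact: XB.
- move=> x y z; rewrite /dX -(subrKA (v y)) nD//; exact: XB.
Qed.

Lemma norm_dist_le x y : dX x y <= nrm (v x) + nrm (v y).
Proof.
have [_ _ _ nD] := nrmX.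
by rewrite /dX (le_trans (nD _ _ _ _))// ?nrmN//; exact: XN.
Qed.

Lemma norm_measurable : induces_topology dX ->
  measurable_fun setT (fun x : borel (subspace_of X0) => nrm (v x)).
Proof.
move=> dtop; apply: measurable_fun_open_lt => a.
(* a sublevel set of the norm is a ball around the origin *)
pose o : subspace_of X0 := exist _ 0 (mem_set linX.1).
rewrite (_ : [set x | _] = [set x : subspace_of X0 | dX x o < a]).
  by apply: metric_ball_open => //; exact: norm_metric.
by apply/seteqP; split => x /=; rewrite /dX subr0.
Qed.

End norm_metric.

(** * Well-posedness of the Bayesian inverse problem *)

Theorem corollary5p1 (R : realType)
    (X' : topologicalLmodType R)
    (sepX' : separable X') (cmX' : completely_metrizable R X')
    (X : set X') (mX : <<s @open X' >> X) (X0 : X !=set0)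
    (k : nat) (Gamma : 'M[R]_k) (spdGamma : spd Gamma)
    (G : borel (subspace_of X0) -> borel 'cV[R]_k)
    (mG : measurable_fun [set: borel (subspace_of X0)] G)
    (prior : probability (borel (subspace_of X0)) R)
    (nuX : {sigma_finite_measure set (borel (subspace_of X0)) -> \bar R})
    (prior_nuX : prior `<< nuX)
    (pi_prior : borel (subspace_of X0) -> R)
    (pi_priorE : is_density nuX prior pi_prior) :
  let posterior :=
    is_posterior (gaussian_likelihood Gamma G) prior nuX pi_prior in
  [/\ forall dX : subspace_of X0 -> subspace_of X0 -> R,
        is_metric dX -> induces_topology dX ->
        well_posed posterior Prob (d_Prok dX),
      well_posed posterior (Prob_ac prior) (d_Hel prior),
      well_posed posterior Prob d_tv
    & forall (nrm : X' -> R) (p : R),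
        let nX := fun x : borel (subspace_of X0) => nrm (subspace_val X0 x) in
        let dX := fun x y : subspace_of X0 =>
          nrm (subspace_val X0 x - subspace_val X0 y) in
        is_linear_subspace X -> is_norm_on X nrm -> induces_topology dX ->
        1 <= p -> Prob_p nX p prior ->
        well_posed posterior (Prob_p nX p) (d_Was dX p)].
Proof.
move=> post; split.
- move=> dX dXm dXtop; apply: (weak_well_posed _ _ spdGamma mG _ _ _ pi_priorE).
    by have [] := dXm.
  by move=> B s; exact: thickening_measurable.
- exact: (Hel_well_posed _ _ spdGamma mG _ _ _ pi_priorE).
- exact: (tv_well_posed _ _ spdGamma mG _ _ _ pi_priorE).
- move=> nrm p nX dX linX nrmX dXtop p1 pprior.
  have [n0 _ _ _] := nrmX; have dXm := norm_metric X0 nrm linX nrmX.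
  have X0x (x : subspace_of X0) : X (subspace_val X0 x).
    by have := svalP x; rewrite inE.
  apply: (Was_well_posed _ _ spdGamma mG _ _ _ pi_priorE) => //.
  + move=> x y; apply: n0; rewrite addrC -scaleN1r; exact: linX.2.
  + by have [] := dXm.
  + by move=> x; exact: n0.
  + exact: norm_dist_le.
  + exact: norm_measurable.
Qed.
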